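(* Let $N\ge 1$ be an integer, let $1\le p<\infty$ and let $u:\mathbb{R}^N\to\mathbb{R}$ be a measurable function satisfying $$\lim_{\lambda\to\infty}\lambda^p\,\mathcal{L}^{2N}\left(\left\{(x,y)\in\mathbb{R}^N\times\mathbb{R}^N:\ \frac{|u(x)-u(y)|}{|x-y|^{\frac{N}{p}+1}}\ge\lambda\right\}\right)=0.$$ Then $u$ is constant.
   Context: $\mathcal{L}^{2N}$ is Lebesgue measure on $\mathbb{R}^N\times\mathbb{R}^N$. The difference quotient is defined for $x\ne y$ (i.e. almost everywhere). As usual for measurable functions, ''$u$ is constant'' means that $u$ coincides almost everywhere with a constant. *)

(* Defs.v *)
From HB Require Import structures.
From mathcomp Require Import all_boot all_order all_algebra.
From mathcomp Require Import all_classical all_reals all_analysis.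

Set Implicit Arguments.
Unset Strict Implicit.
Unset Printing Implicit Defensive.

Import Order.TTheory GRing.Theory Num.Theory.
Import numFieldNormedType.Exports.

Local Open Scope classical_set_scope.
Local Open Scope ring_scope.

(* R^n is [n.-tuple R], with its product (Borel) sigma-algebra. Lebesgue
   measure on the Borel sets of R^n is built by recursion on n, as the product
   of the measures on R and on R^(n-1); it is completed further below. *)
Section lebesgue_succ.
Context (R : realType) (n : nat).

Definition tuple_cons (x : measurableTypeR R * n.-tuple R) : n.+1.-tuple R :=
  [tuple of x.1 :: x.2].

Lemma measurable_tuple_cons : measurable_fun [set: _] tuple_cons.
Proof. exact: (@measurable_cons _ _ _ R fst n snd). Qed.

HB.instance Definition _ :=
  @isMeasurableFun.Build _ _ _ _ tuple_cons measurable_tuple_cons.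

Variable m : {sigma_finite_measure set (n.-tuple R) -> \bar R}.

Definition lebesgue_succ : set (n.+1.-tuple R) -> \bar R :=
  pushforward (lebesgue_measure \x m)%E tuple_cons.

Let lebesgue_succ0 : lebesgue_succ set0 = 0%E.
Proof. by rewrite /lebesgue_succ /pushforward preimage_set0 measure0. Qed.

Let lebesgue_succ_ge0 A : (0 <= lebesgue_succ A)%E.
Proof. exact: measure_ge0. Qed.

Let lebesgue_succ_sigma_additive : semi_sigma_additive lebesgue_succ.
Proof.
exact: (@measure_semi_sigma_additive _ _ _
  (pushforward (lebesgue_measure \x m)%E tuple_cons)).
Qed.

HB.instance Definition _ := isMeasure.Build _ _ _ lebesgue_succ
  lebesgue_succ0 lebesgue_succ_ge0 lebesgue_succ_sigma_additive.

Lemma lebesgue_succE (A : set R) (B : set (n.-tuple R)) :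
  measurable A -> measurable B ->
  lebesgue_succ [set x | A (thead x) /\ B [tuple of behead x]] =
  (lebesgue_measure A * m B)%E.
Proof.
move=> mA mB; rewrite -product_measure1E//; congr product_measure1.
by apply/seteqP; split=> -[a b] /=; rewrite theadE;
  have -> : [tuple of behead (tuple_cons (a, b))] = b by apply: val_inj.
Qed.

Let lebesgue_succ_sigma_finite : sigma_finite setT lebesgue_succ.
Proof.
have /sigma_finiteP[F [TF ndF Foo]] := sigma_finiteT (@lebesgue_measure R).
have /sigma_finiteP[G [TG ndG Goo]] := sigma_finiteT m.
exists (fun k => [set x | F k (thead x) /\ G k [tuple of behead x]]).
  apply/esym; rewrite -subTset => x _.
  have [i _ Fi] : (\bigcup_i F i) (thead x) by rewrite -TF.
  have [j _ Gj] : (\bigcup_i G i) [tuple of behead x] by rewrite -TG.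
  exists (maxn i j) => //; split.
    by move: Fi; exact/subsetPset/ndF/leq_maxl.
  by move: Gj; exact/subsetPset/ndG/leq_maxr.
move=> k; have [mF Fk] := Foo k; have [mG Gk] := Goo k; split.
  apply: measurableI.
    rewrite -[X in measurable X]setTI.
    exact: (@measurable_tnth _ R n.+1 ord0).
  rewrite -[X in measurable X]setTI.
  exact: measurable_behead.
by rewrite lebesgue_succE// lte_mul_pinfty// ge0_fin_numE.
Qed.

HB.instance Definition _ := Measure_isSigmaFinite.Build _ _ _ lebesgue_succ
  lebesgue_succ_sigma_finite.

End lebesgue_succ.

Fixpoint borel_lebesgue (R : realType) (n : nat) :
    {sigma_finite_measure set (n.-tuple R) -> \bar R} :=
  match n with
  | 0 => \d_([tuple] : 0.-tuple R)
  | k.+1 => lebesgue_succ (borel_lebesgue R k)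
  end.

Lemma borel_lebesgue_box (R : realType) (n : nat) (A : 'I_n -> set R) :
  (forall i, measurable (A i)) ->
  borel_lebesgue R n [set x | forall i, A i (tnth x i)] =
  (\prod_(i < n) lebesgue_measure (A i))%E.
Proof.
elim: n A => [|n IHn] A mA.
  by rewrite big_ord0 /= diracE mem_set//= => -[].
rewrite big_ord_recl -IHn => [|i]; last exact: mA.
rewrite -[LHS]/(lebesgue_succ _ _) -lebesgue_succE//; last first.
  rewrite (_ : [set _ | _] =
    \bigcap_(i in [set: 'I_n]) [set x | A (lift ord0 i) (tnth x i)]).
    apply: fin_bigcap_measurable => // i _; rewrite -[X in measurable X]setTI.
    exact: (@measurable_tnth _ R n i).
  by apply/seteqP; split=> x h i; [move=> _; exact: h|exact: (h i I)].
congr lebesgue_succ; apply/seteqP.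
have tnth_lift (x : n.+1.-tuple R) i :
    tnth x (lift ord0 i) = tnth [tuple of behead x] i.
  by rewrite {1}(tuple_eta x) tnthS.
split=> x /= => [Ax|[A0 Ax] i].
  by split=> [|i]; [exact: Ax|rewrite -tnth_lift; exact: Ax].
by case: (unliftP ord0 i) => [j|] ->//; rewrite tnth_lift; exact: Ax.
Qed.

(* The completion is taken on the Lebesgue sigma-algebra, i.e., the
   Caratheodory sigma-algebra of the outer measure induced by the Borel
   measure; [lebesgue_type R n] is R^n with that sigma-algebra. *)
Definition lebesgue_type (R : realType) (n : nat) :=
  caratheodory_type (mu_ext (borel_lebesgue R n)).

Definition lebesgue (R : realType) (n : nat) :
    set (lebesgue_type R n) -> \bar R :=
  @completed_measure_extension _ _ _ (borel_lebesgue R n).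
Arguments lebesgue R n : clear implicits.

HB.instance Definition _ (R : realType) (n : nat) :=
  Measure.on (lebesgue R n).

(* Lebesgue measure on R^n * R^n, completed in the same way. *)
Definition lebesgue2_type (R : realType) (n : nat) :=
  caratheodory_type (mu_ext (borel_lebesgue R n \x borel_lebesgue R n)%E).

Definition lebesgue2 (R : realType) (n : nat) :
    set (lebesgue2_type R n) -> \bar R :=
  @completed_measure_extension _ _ _ (borel_lebesgue R n \x borel_lebesgue R n)%E.
Arguments lebesgue2 R n : clear implicits.

HB.instance Definition _ (R : realType) (n : nat) :=
  Measure.on (lebesgue2 R n).

Definition euclidean_dist (R : realType) (n : nat) (x y : n.-tuple R) : R :=
  Num.sqrt (\sum_(i < n) (tnth x i - tnth y i) ^+ 2).

(* Main.v *)
(** Put [D x y = min 1 |u x - u y|], which satisfies the triangle inequality, and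
    let [E rho] be the integral of [D] over the pairs with [x] in a fixed box and
    [rho / 2 < |x - y| <= rho].  Cutting the segment from [x] to [y] into [k]
    equal pieces and changing variables gives [E rho <= k ^ (N + 1) E (rho / k)],
    up to an enlargement of the box; so [2 ^ (j (N + 1)) E (2 ^ -j)] is
    essentially nondecreasing in [j], and it is enough to find arbitrarily large
    [j] for which it is small.  Decomposing [D] along the dyadic levels of the
    difference quotient bounds it by a small constant plus a sum of terms
    [2 ^ m |E_m|], where [E_m] is the superlevel set at height [c 2 ^ (m / p)];
    each of them tends to [0] by hypothesis, but their number grows with [j] (and
    for [p = 1] there is no gain from a geometric series).  Summing over
    [K <= j < 2 K] repairs this: the shells are disjoint, so the [O(K)] levels
    are used once for all the [K] shells, and the average over [j] is small. *)

From HB Require Import structures.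
Require Import Defs.
From mathcomp Require Import all_boot all_order all_algebra.
From mathcomp Require Import all_classical all_reals all_analysis.
From mathcomp Require Import measurable_realfun.
From mathcomp Require Import ring lra zify.
Import Order.TTheory GRing.Theory Num.Theory.
Import numFieldNormedType.Exports.
Local Open Scope classical_set_scope.
Local Open Scope ring_scope.

(** * Affine changes of variables *)

Section affine.
Context {R : realType}.

Definition affine {n : nat} (c : R) (a z : n.-tuple R) : n.-tuple R :=
  [tuple tnth a i + c * tnth z i | i < n].

Lemma measurable_affine {n} (c : R) (a : n.-tuple R) :
  measurable_fun [set: n.-tuple R] (affine c a).
Proof.
apply/measurable_fun_tnthP => i.
rewrite (_ : _ \o _ = fun z : n.-tuple R => tnth a i + c * tnth z i);
  last first.
  by apply/funext => z /=; rewrite tnth_mktuple.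
apply: measurable_funD => //; apply: measurable_funM => //.
exact: measurable_tnth.
Qed.

(** The rescaled pushforward is a measure that agrees with Lebesgue measure on the intervals []x,
    y]], and these determine Lebesgue measure. *)
Lemma lebesgue_measure_affine (c a : R) (A : set R) : 0 < c -> measurable A ->
  (c%:E * lebesgue_measure ((fun x => (a + c * x)%R) @^-1` A) =
   lebesgue_measure A)%E.
Proof.
move=> c0 mA.
pose f : measurableTypeR R -> measurableTypeR R := fun x => a + c * x.
have mf : measurable_fun [set: measurableTypeR R] f.
  by apply: measurable_funD => //; apply: measurable_funM.
pose m := mscale (NngNum (ltW c0)) (pushforward lebesgue_measure f).
apply/esym; rewrite -[RHS]/(m mf A); apply: lebesgue_measure_unique => //.
move=> _ [[x y]] _ <-.
rewrite -[RHS]/(c%:E * lebesgue_measure (f @^-1` `]x, y]%classic))%E.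
have -> : f @^-1` `]x, y]%classic = `](x - a) / c, (y - a) / c]%classic.
  apply/seteqP.
  by split => z /=; rewrite /f !in_itv/= ltr_pdivrMr// ler_pdivlMr//;
     rewrite ltrBlDl lerBrDl mulrC.
rewrite !lebesgue_measure_itv/= !lte_fin ltr_pM2r ?invr_gt0// ltrD2r.
case: ifPn => _; last by rewrite mule0.
by rewrite -!EFinB -EFinM; congr EFin; field; rewrite gt_eqF.
Qed.

(** Induction on the dimension: through [tuple_cons] the map splits into a one-dimensional affine
    map on the head and an affine map on the tail, so that it suffices to compare the two measures
    on rectangles. *)
Lemma borel_lebesgue_affine n (c : R) (a : n.-tuple R) (A : set (n.-tuple R)) :
  0 < c -> measurable A ->
  ((c ^+ n)%:E * borel_lebesgue R n (affine c a @^-1` A)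
    = borel_lebesgue R n A)%E.
Proof.
move=> c0; elim: n => [|n IHn] in a A *; move=> mA.
  rewrite expr0 mul1e; suff -> : affine c a @^-1` A = A by [].
  by apply/seteqP; split=> x /=; rewrite [affine _ _ _]tuple0 [x]tuple0.
pose b := [tuple of behead a]; pose X := @tuple_cons R n @^-1` A.
have mX : measurable X by rewrite -[X]setTI; exact: measurable_tuple_cons.
pose leb2 := (lebesgue_measure \x borel_lebesgue R n)%E.
rewrite -[RHS]/(leb2 X).
rewrite -[X in (_ * X)%E]/(leb2 (@tuple_cons R n @^-1` (affine c a @^-1` A))).
pose F (z : measurableTypeR R * n.-tuple R) : measurableTypeR R * n.-tuple R :=
  (thead a + c * z.1, affine c b z.2).
have mF : measurable_fun [set: _] F.
  apply/measurable_fun_pairP; split.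
    apply: measurable_funD => //; apply: measurable_funM => //.
  exact: (measurableT_comp (measurable_affine c (b : n.-tuple R))
    measurable_snd).
have cn0 : 0 <= c ^+ n.+1 by rewrite exprn_ge0// ltW.
pose m := mscale (NngNum cn0)
  (pushforward (lebesgue_measure \x borel_lebesgue R n)%E F).
transitivity (m mF X).
  rewrite -[RHS]/((c ^+ n.+1)%:E * leb2 (F @^-1` X))%E.
  suff -> : @tuple_cons R n @^-1` (affine c a @^-1` A) = F @^-1` X by [].
  suff h z : affine c a (tuple_cons z) = tuple_cons (F z).
    by apply/seteqP; split => z; rewrite /X /= h.
  apply/eq_from_tnth => i; rewrite tnth_mktuple.
  case: (unliftP ord0 i) => [j|] ->//.
  rewrite /tuple_cons !tnthS tnth_mktuple.
  by rewrite {1}(tuple_eta a) tnthS.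
apply/esym; apply: product_measure_unique => // B C mB mC.
rewrite -[LHS]/((c ^+ n.+1)%:E * leb2 (F @^-1` (B `*` C)))%E.
have -> : F @^-1` (B `*` C) =
    ((fun x => thead a + c * x) @^-1` B) `*` (affine c b @^-1` C).
  by apply/seteqP; split => -[].
have mg : measurable_fun [set: measurableTypeR R]
    ((fun x => thead a + c * x) : _ -> measurableTypeR R).
  by apply: measurable_funD => //; apply: measurable_funM.
have mB' := mg measurableT _ mB; rewrite setTI in mB'.
have mC' : measurable (affine c (b : n.-tuple R) @^-1` C).
  by rewrite -[X in measurable X]setTI; exact: measurable_affine.
rewrite /leb2 (product_measure1E _ _ mB' mC').
by rewrite exprS EFinM muleACA lebesgue_measure_affine// IHn.
Qed.

Lemma ge0_integral_affine n (c : R) (a : n.-tuple R)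
    (f : n.-tuple R -> \bar R) :
  0 < c -> measurable_fun [set: n.-tuple R] f -> (forall x, 0 <= f x)%E ->
  (\int[borel_lebesgue R n]_x f x =
   (c ^+ n)%:E * \int[borel_lebesgue R n]_z f (affine c a z))%E.
Proof.
move=> c0 mf f0.
have cn0 : 0 <= c ^+ n by rewrite exprn_ge0// ltW.
rewrite -[X in (_ * X)%E](@ge0_integral_pushforward _ _ _ _ _ _
  (measurable_affine c a) _ setT f)//.
rewrite -(@ge0_integral_mscale _ _ _ _ setT _ (NngNum cn0))//.
  exact: measurable_affine.
move=> ma; apply: eq_measure_integral => A mA _ /=.
by rewrite -(@borel_lebesgue_affine _ c a).
Qed.
End affine.

(** * Borel versions of completed-measurable functions *)

Section completion.
Context {d : measure_display} {T : measurableType d} {R : realType}.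
Variable mu : {measure set T -> \bar R}.
Local Notation "mu^*" := (mu_ext mu).

Lemma measure_bigcup0 (F : (set T)^nat) : (forall n, measurable (F n)) ->
  (forall n, mu (F n) = 0%E) -> mu (\bigcup_n F n) = 0%E.
Proof.
move=> mF F0; apply/eqP; rewrite eq_le measure_ge0 andbT.
have mU := bigcupT_measurable _ mF.
apply: le_trans (measure_sigma_subadditive mu mF mU (@subset_refl _ _)) _.
by rewrite eseries0// => n _ _.
Qed.

(** The measurable hull: intersect countable measurable covers of [E] whose measures exceed its
    outer measure by at most [1 / (n + 1)]. *)
Lemma mu_ext_hull (E : set T) : (mu^* E < +oo)%E ->
  exists A, [/\ measurable A, E `<=` A & mu A = mu^* E].
Proof.
move=> Eoo.
have Efin : mu^* E \is a fin_num by rewrite ge0_fin_numE// mu_ext_ge0.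
have hull n : exists B, [/\ measurable B, E `<=` B &
    (mu B <= mu^* E + n.+1%:R^-1%:E)%E].
  have n0 : 0 < n.+1%:R^-1 :> R by rewrite invr_gt0.
  have [_ [F [mF EF] <-] Flt] := lb_ereal_inf_adherent n0 Efin.
  exists (\bigcup_k F k); split => //; first exact: bigcupT_measurable.
  apply: le_trans (ltW Flt).
  apply: measure_sigma_subadditive => //; exact: bigcupT_measurable.
have [B hB] := choice hull.
exists (\bigcap_n B n); have mB : measurable (\bigcap_n B n).
  by apply: bigcapT_measurable => n; have [] := hB n.
have EB : E `<=` \bigcap_n B n by move=> x Ex n _; have [_ + _] := hB n; exact.
split => //; apply/eqP; rewrite eq_le; apply/andP; split; last first.
  by rewrite -(measurable_mu_extE mu mB) le_mu_ext.
apply/lee_addgt0Pr => _/posnumP[e]; near \oo => n.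
have [mBn _ muBn] := hB n.
apply: (@le_trans _ _ (mu (B n))).
  by rewrite le_measure ?inE//; exact: bigcap_inf.
apply: (le_trans muBn).
rewrite leeD2l// lee_fin ltW//; near: n; exact: near_infty_natSinv_lt.
Unshelve. all: by end_near. Qed.

(** Take for [A] a hull of [E]. Since the outer measure is finite and additive on Caratheodory sets,
    [A] minus [E] has outer measure zero; [N] is a hull of this difference. *)
Lemma caratheodory_borel_fin (E : set T) :
  (mu^*).-cara.-measurable E -> (mu^* E < +oo)%E ->
  exists A N, [/\ measurable A, measurable N, mu N = 0%E &
    forall x, ~ N x -> (E x <-> A x)].
Proof.
move=> mE Eoo; have [A [mA EA muA]] := mu_ext_hull _ Eoo.
have cA : (mu^*).-cara.-measurable A by exact: caratheodory_measurable_mu_ext.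
have DE : mu^* (A `\` E) = 0%E.
  have Aoo : (mu^* A < +oo)%E by rewrite measurable_mu_extE// muA.
  rewrite [LHS](@measureD _ _ _ (@completed_measure_extension _ _ _ mu)
    A E cA mE Aoo).
  rewrite setIidr// [X in (X - _)%E]measurable_mu_extE// muA subee//.
  by rewrite ge0_fin_numE// mu_ext_ge0.
have [|N [mN DN muN]] := @mu_ext_hull (A `\` E); first by rewrite DE.
exists A, N; split => //; first by rewrite muN.
move=> x Nx; split => [/EA//|Ax]; apply: contrapT => Ex; apply: Nx.
exact: DN.
Qed.

Lemma caratheodory_borel (E : set T) : sigma_finite [set: T] mu ->
  (mu^*).-cara.-measurable E ->
  exists A N, [/\ measurable A, measurable N, mu N = 0%E &
    forall x, ~ N x -> (E x <-> A x)].
Proof.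
move=> [S TS mS] mE.
have h n : exists AN : set T * set T, [/\ measurable AN.1, measurable AN.2,
    mu AN.2 = 0%E & forall x, ~ AN.2 x -> (E x /\ S n x <-> AN.1 x)].
  have [mSn Sn] := mS n.
  have cS : (mu^*).-cara.-measurable (S n).
    exact: caratheodory_measurable_mu_ext.
  have [||A [N [? ? ? ?]]] := @caratheodory_borel_fin (E `&` S n).
  - exact: measurableI.
  - apply: le_lt_trans Sn; rewrite -(measurable_mu_extE mu mSn).
    by apply: le_mu_ext; exact: subIsetr.
  - by exists (A, N).
have [F hF] := choice h.
exists (\bigcup_n (F n).1), (\bigcup_n (F n).2).
have mN n : measurable (F n).2 by have [] := hF n.
split.
- by apply: bigcupT_measurable => n; have [] := hF n.
- exact: bigcupT_measurable.
- apply: measure_bigcup0 => // n; by have [] := hF n.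
- move=> x Nx; split => [Ex|[n _ An]].
    have : [set: T] x by []. rewrite TS => -[n _ Snx]; exists n => //.
    have [_ _ _ ] := hF n; move=> /(_ x) [|/(_ (conj Ex Snx))//].
    by move=> Fn; apply: Nx; exists n.
  have [_ _ _ ] := hF n; move=> /(_ x) [|_ /(_ An)[]//].
  by move=> Fn; apply: Nx; exists n.
Qed.

(** The superlevel sets of [f] at rational heights are Borel up to null sets. There are countably
    many of them, so one Borel null set contains all the exceptions, and [f] is made Borel by
    redefining it there. *)
Lemma caratheodory_measurable_fun_borel (f : T -> R) :
  sigma_finite [set: T] mu ->
  measurable_fun [set: caratheodory_type mu^*]
    (f : caratheodory_type mu^* -> R) ->
  exists g : T -> R, exists N : set T, [/\ measurable_fun [set: T] g,
    measurable N, mu N = 0%E & forall x, ~ N x -> f x = g x].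
Proof.
move=> sf mf.
have h (q : rat) : exists AN : set T * set T, [/\ measurable AN.1,
    measurable AN.2,
    mu AN.2 = 0%E & forall x, ~ AN.2 x -> (ratr q < f x <-> AN.1 x)].
  have [|A [N [? ? ? ?]]] := @caratheodory_borel (f @^-1` `]ratr q, +oo[) sf.
    by rewrite -[X in measurable X]setTI; apply: mf.
  exists (A, N); split => //= x Nx.
  have : (f @^-1` `]ratr q, +oo[) x <-> A x by auto.
  by rewrite /= in_itv/= andbT.
have [F hF] := choice h.
(* The rationals are enumerated by [unpickle]; a code of no rational falls back on [0], which only
   repeats one exceptional set. *)
pose N := \bigcup_n (F (odflt 0 (unpickle n))).2.
have mN : measurable N.
  by apply: bigcupT_measurable => n; have [] := hF (odflt 0 (unpickle n)).
have NF x q : ~ N x -> ~ (F q).2 x.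
  by apply: contra_not => Fx; exists (pickle q) => //; rewrite pickleK.
exists (fun x => if x \in N then 0 else f x), N; split => //.
- move=> _; apply: (measurability _ (RGenOInfty.measurableE R)) => //.
  move=> _ [_ [r ->] <-]; rewrite setTI.
  (* Off [N], the condition [r < f x] means [r < ratr q < f x] for some rational [q]; on [N] the new
     function is [0], so there the condition is [r < 0]. *)
  rewrite [X in measurable X](_ : _ =
     ((\bigcup_(q : rat) ((F q).1 `&` [set x | r < ratr q])) `\` N) `|`
      (N `&` [set x | r < 0])); last first.
    apply/seteqP; split => x /=; rewrite in_itv/= andbT.
      have [/set_mem Nx r0|/negP Nx rf] := boolP (x \in N); first by right.
      have {}Nx : ~ N x by move/mem_set.
      left; split => //; have /rat_in_itvoo[q] := rf.
      rewrite in_itv/= => /andP[rq qf]; exists q => //; split => //.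
      by have [_ _ _ /(_ x (NF _ _ Nx))[/(_ qf)]] := hF q.
    move=> [[[q _ [Fq rq]] Nx]|[Nx r0]]; last by rewrite mem_set.
    rewrite memNset//; apply: lt_trans rq _.
    by have [_ _ _ /(_ x (NF _ _ Nx))[_ /(_ Fq)]] := hF q.
  have mc (P : Prop) : measurable [set x : T | P].
    by have [p|p] := pselect P; [rewrite (_ : [set _ | _] = setT)|
      rewrite (_ : [set _ | _] = set0)] => //; apply/seteqP; split.
  apply: measurableU; last exact: measurableI.
  apply: measurableD => //; apply: bigcupT_measurable_rat => q.
  by apply: measurableI => //; have [] := hF q.
- by apply: measure_bigcup0 => n; have [] := hF (odflt 0 (unpickle n)).
- by move=> x Nx; rewrite memNset.
Qed.
End completion.

(** * The energy of a dyadic shell *)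

Section pairs.
Context {R : realType} {n : nat}.
Local Notation T := (n.-tuple R).
Local Notation mu := (borel_lebesgue R n).

Lemma affine_affine (j : nat) (x z : T) :
  affine 1 (affine j%:R x z) z = affine j.+1%:R x z.
Proof.
by apply/eq_from_tnth => i; rewrite !tnth_mktuple -[j.+1%:R]natr1; ring.
Qed.

Lemma euclidean_dist_affine (j : nat) (c : R) (x z : T) : 0 <= c ->
  euclidean_dist x (affine c x z) = c * Num.sqrt (\sum_(i < n) tnth z i ^+ 2).
Proof.
move=> c0; rewrite /euclidean_dist -{2}(ger0_norm c0) -sqrtr_sqr.
rewrite -sqrtrM ?sqr_ge0//.
rewrite mulr_sumr; congr Num.sqrt; apply: eq_bigr => i _.
by rewrite tnth_mktuple opprD addrA subrr add0r sqrrN exprMn.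
Qed.

Lemma le_euclidean_dist (x y : T) i :
  `|tnth x i - tnth y i| <= euclidean_dist x y.
Proof.
rewrite -sqrtr_sqr ler_wsqrtr// (bigD1 i)//= lerDl sumr_ge0// => j _.
exact: sqr_ge0.
Qed.

Lemma measurable_affine2 d (S : measurableType d) (c : R) (f g : S -> T) :
  measurable_fun [set: S] f -> measurable_fun [set: S] g ->
  measurable_fun [set: S] (fun s => affine c (f s) (g s)).
Proof.
move=> /measurable_fun_tnthP mf /measurable_fun_tnthP mg.
apply/measurable_fun_tnthP => i.
rewrite (_ : _ \o _ = fun s => tnth (f s) i + c * tnth (g s) i); last first.
  by apply/funext => z /=; rewrite tnth_mktuple.
apply: measurable_funD; first exact: mf.
by apply: measurable_funM => //; exact: mg.
Qed.

Lemma measurable_euclidean_dist :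
  measurable_fun [set: T * T] (fun z => euclidean_dist z.1 z.2).
Proof.
apply: (measurableT_comp (f := @Num.sqrt R)).
  apply: continuous_measurable_fun; exact: sqrt_continuous.
apply: measurable_sum => i; apply: measurable_funX; apply: measurable_funB.
  exact: (measurableT_comp (measurable_tnth i) measurable_fst).
exact: (measurableT_comp (measurable_tnth i) measurable_snd).
Qed.

Variable f : T * T -> \bar R.
Hypotheses (mf : measurable_fun [set: T * T] f) (f0 : forall z, (0 <= f z)%E).

(** For fixed [x], substitute [y = x + c z] in the inner integral. *)
Lemma ge0_integral2_affine (c : R) : 0 < c ->
  (\int[mu]_x \int[mu]_y f (x, y) =
   (c ^+ n)%:E * \int[mu]_x \int[mu]_z f (x, affine c x z))%E.
Proof.
move=> c0; rewrite -ge0_integralZl//; last 3 first.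
- pose g z := f (z.1, affine c z.1 z.2).
  apply: (measurable_fun_fubini_tonelli_F g) => [|z]; last exact: f0.
  apply: measurableT_comp => //; apply/measurable_fun_pair => //.
  exact: measurable_affine2.
- by move=> x _; apply: integral_ge0.
- by rewrite lee_fin exprn_ge0// ltW.
apply: eq_integral => x _; rewrite (@ge0_integral_affine _ _ c x)//.
exact: measurableT_comp.
Qed.

(** All consecutive pairs [(x + j z, x + (j + 1) z)] contribute equally: for fixed [z] they differ
    by a translation of [x]. *)
Lemma ge0_integral2_shift (j : nat) :
  (\int[mu]_x \int[mu]_z f (affine j%:R x z, affine j.+1%:R x z) =
   \int[mu]_x \int[mu]_y f (x, y))%E.
Proof.
pose g i z := f (affine i%:R z.1 z.2, affine i.+1%:R z.1 z.2).
have mg i : measurable_fun [set: T * T] (g i).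
  apply: measurableT_comp => //.
  by apply/measurable_fun_pair; exact: measurable_affine2.
have g0 i z : (0 <= g i z)%E by exact: f0.
have affine0 (x z : T) : affine 0 x z = x.
  by apply/eq_from_tnth => i; rewrite tnth_mktuple mul0r addr0.
transitivity (\int[mu]_x \int[mu]_z g 0%N (x, z))%E; last first.
  rewrite (ge0_integral2_affine _ ltr01) expr1n mul1e.
  apply: eq_integral => x _; apply: eq_integral => z _.
  by rewrite /g /= affine0.
rewrite -[LHS]/(\int[mu]_x \int[mu]_z g j (x, z))%E.
(* The integrals are exchanged because the translation acts on [x] with [z] fixed. *)
rewrite (fubini_tonelli _ (mg j) (g0 j)) (fubini_tonelli _ (mg 0%N) (g0 0%N)).
apply: eq_integral => z _.
pose o : T := [tuple 0 | i < n].
have shift (x : T) : affine 1 (affine j%:R o z) x = affine j%:R x z.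
  by apply/eq_from_tnth => i; rewrite !tnth_mktuple add0r mul1r addrC.
(* The translation by [j z], written as an affine map of slope [1]; [o] is the origin. *)
rewrite (@ge0_integral_affine _ _ 1 (affine j%:R o z)
  (fun x => g 0%N (x, z)))//.
  rewrite expr1n mul1e; apply: eq_integral => x _.
  by rewrite /g/= shift affine0 affine_affine.
exact: measurableT_comp.
Qed.

End pairs.

Definition box {R : realType} {n : nat} (r : R) : set (n.-tuple R) :=
  [set x | forall i, `|tnth x i| <= r].

(** Only the first point is confined to the box. The annulus is half-open, so that the shells of
    radii [2 ^- k] are disjoint. *)
Definition shell {R : realType} {n : nat} (r rho : R) :
    set (n.-tuple R * n.-tuple R) :=
  [set z | box r z.1 /\ rho / 2 < euclidean_dist z.1 z.2 <= rho].

(** The cap at [1] keeps the triangle inequality and bounds the number of dyadic levels that matter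
    at a given scale. *)
Definition oscillation {R : realType} {n : nat} (u : n.-tuple R -> R)
  (z : n.-tuple R * n.-tuple R) : R := Num.min 1 `|u z.1 - u z.2|.

Definition shell_density {R : realType} {n : nat} (u : n.-tuple R -> R)
    (r rho : R) (z : n.-tuple R * n.-tuple R) : \bar R :=
  (\1_(shell r rho) z * oscillation u z)%:E.

Definition shell_energy {R : realType} {n : nat} (u : n.-tuple R -> R)
    (r rho : R) : \bar R :=
  (\int[borel_lebesgue R n]_x \int[borel_lebesgue R n]_y
     shell_density u r rho (x, y))%E.

Lemma sume_const_ord {R : realType} (k : nat) (x : \bar R) :
  (\sum_(j < k) x = k%:R%:E * x)%E.
Proof.
rewrite mule_natl; elim: k => [|k IHk]; first by rewrite big_ord0.
by rewrite big_ord_recl IHk muleS.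
Qed.

Section shell_energy.
Context {R : realType} {n : nat} (u : n.-tuple R -> R).
Hypothesis mfu : measurable_fun [set: n.-tuple R] u.
Local Notation T := (n.-tuple R).

Lemma measurable_box (r : R) : measurable (box r : set T).
Proof.
rewrite (_ : box r =
    \bigcap_(i in [set: 'I_n]) (fun x : T => `|tnth x i|) @^-1` `]-oo, r]).
  apply: fin_bigcap_measurable => // i _; rewrite -[X in measurable X]setTI.
  apply: (measurableT_comp (f := @Num.norm _ R)) => //.
  exact: measurable_tnth.
apply/seteqP; split => x /= xr i; first by move=> _; rewrite /= in_itv/=.
by have := xr i I; rewrite /= in_itv.
Qed.

Lemma measurable_shell (r rho : R) : measurable (shell r rho : set (T * T)).
Proof.
rewrite (_ : shell r rho = (fst @^-1` box r) `&`
  ((fun z : T * T => euclidean_dist z.1 z.2) @^-1` `]rho / 2, rho])).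
  apply: measurableI; rewrite -[X in measurable X]setTI.
    by apply: measurable_fst => //; exact: measurable_box.
  by apply: measurable_euclidean_dist.
by apply/seteqP; split => x /=; rewrite in_itv.
Qed.

Lemma oscillation_ge0 z : 0 <= oscillation u z.
Proof. by rewrite le_min ler01 normr_ge0. Qed.

Lemma oscillation_triangle (y x z : T) :
  oscillation u (x, z) <= oscillation u (x, y) + oscillation u (y, z).
Proof.
rewrite /oscillation /=; have := ler_distD (u y) (u x) (u z).
have := normr_ge0 (u x - u y); have := normr_ge0 (u y - u z).
by rewrite /Order.min; do 3 case: ifP; lra.
Qed.

Lemma oscillation_chain (x z : T) (k : nat) :
  oscillation u (affine 0%:R x z, affine k%:R x z) <=
  \sum_(j < k) oscillation u (affine j%:R x z, affine j.+1%:R x z).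
Proof.
elim: k => [|k IHk].
  by rewrite big_ord0 /oscillation/= subrr normr0 ge_min lexx orbT.
rewrite big_ord_recr/=.
apply: le_trans (oscillation_triangle (affine k%:R x z) _ _) _.
by rewrite lerD2r.
Qed.

Lemma measurable_oscillation : measurable_fun [set: T * T] (oscillation u).
Proof.
apply: measurable_minr => //; apply: (measurableT_comp (f := @Num.norm _ R)) => //.
apply: measurable_funB.
  exact: (measurableT_comp mfu measurable_fst).
exact: (measurableT_comp mfu measurable_snd).
Qed.

Lemma measurable_shell_density r rho :
  measurable_fun [set: T * T] (shell_density u r rho).
Proof.
apply/measurable_EFinP.
apply: measurable_funM; last exact: measurable_oscillation.
apply: measurable_indic; exact: measurable_shell.
Qed.

Lemma shell_density_ge0 r rho z : (0 <= shell_density u r rho z)%E.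
Proof. by rewrite lee_fin mulr_ge0// oscillation_ge0. Qed.

(** Each of the [k] pieces of the segment from [x] to [x + k z] has length [|z|], hence lies in the
    shell of radius [rho / k]. Its starting point is within [rho] of [x], which explains the box of
    size [r + rho]. *)
Lemma shell_density_chain (r rho : R) (k : nat) (x z : T) :
  (0 < k)%N -> 0 < rho ->
  (shell_density u r rho (x, affine k%:R x z) <=
   \sum_(j < k) shell_density u (r + rho) (rho / k%:R)
     (affine j%:R x z, affine j.+1%:R x z))%E.
Proof.
move=> k0 rho0; rewrite sumEFin lee_fin.
have kR : 0 < k%:R :> R by rewrite ltr0n.
have affine0 : affine 0%:R x z = x.
  by apply/eq_from_tnth => i; rewrite tnth_mktuple mul0r addr0.
set e := Num.sqrt (\sum_(i < n) tnth z i ^+ 2).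
have dist1 j : euclidean_dist (affine j%:R x z) (affine j.+1%:R x z) = e.
  by rewrite -affine_affine euclidean_dist_affine// mul1r.
have [/set_mem [/= xr]|xNr] := boolP ((x, affine k%:R x z) \in shell r rho);
  last first.
  rewrite indicE (negbTE xNr) mul0r sumr_ge0// => j _.
  by rewrite mulr_ge0// oscillation_ge0.
rewrite euclidean_dist_affine ?ler0n// -/e => /andP[rho2 erho].
have in_shell (j : 'I_k) :
    (affine j%:R x z, affine j.+1%:R x z) \in shell (r + rho) (rho / k%:R).
  rewrite inE; split => /=; last first.
    by rewrite dist1 mulrAC ltr_pdivrMr// ler_pdivlMr// [e * _]mulrC rho2.
  move=> i; rewrite tnth_mktuple (le_trans (ler_normD _ _))// lerD//.
  have ei : `|tnth z i| <= e.
    have := le_euclidean_dist (affine 0%:R x z) (affine 1%:R x z) i.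
    rewrite dist1 !tnth_mktuple mul0r mul1r addr0 opprD addrA subrr add0r.
    by rewrite normrN.
  rewrite normrM ger0_norm ?ler0n// (le_trans _ erho)//.
  by rewrite ler_pM// ler_nat ltnW.
apply: (@le_trans _ _ (oscillation u (x, affine k%:R x z))).
  by rewrite ler_piMl ?oscillation_ge0// indicE lern1 leq_b1.
have := oscillation_chain x z k; rewrite affine0 => /le_trans; apply.
by apply: ler_sum => j _; rewrite indicE in_shell mul1r.
Qed.

(** A factor [k ^ n] comes from the substitution [y = x + k z]; one more factor [k] comes from the
    [k] pieces, whose integrals are equal by [ge0_integral2_shift]. *)
Lemma shell_energy_chain (r rho : R) (k : nat) : (0 < k)%N -> 0 < rho ->
  (shell_energy u r rho <=
   (k%:R ^+ n.+1)%:E * shell_energy u (r + rho) (rho / k%:R))%E.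
Proof.
move=> k0 rho0.
have kR : 0 < k%:R :> R by rewrite ltr0n.
rewrite -[leLHS]/(\int[_]_x \int[_]_y shell_density u r rho (x, y))%E.
rewrite (ge0_integral2_affine _ _ (shell_density_ge0 _ _) _ kR); last first.
  exact: measurable_shell_density.
rewrite exprSr EFinM -muleA lee_pmul2l//; last by rewrite lte_fin exprn_gt0.
pose f := shell_density u (r + rho) (rho / k%:R).
have mf : measurable_fun [set: T * T] f by exact: measurable_shell_density.
have f0 : forall z, (0 <= f z)%E by exact: shell_density_ge0.
pose g j (z : T * T) := f (affine j%:R z.1 z.2, affine j.+1%:R z.1 z.2).
have mg j : measurable_fun [set: T * T] (g j).
  apply: measurableT_comp => //.
  by apply/measurable_fun_pair; exact: measurable_affine2.
have g0 j z : (0 <= g j z)%E by exact: f0.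
apply: (@le_trans _ _ (\int[borel_lebesgue R n]_x \int[borel_lebesgue R n]_z
    (\sum_(j < k) g j (x, z)))%E).
  apply: ge0_le_integral => //.
  - move=> x _; apply: integral_ge0 => z _; exact: shell_density_ge0.
  - apply: (measurable_fun_fubini_tonelli_F
        (fun z => shell_density u r rho (z.1, affine k%:R z.1 z.2))).
      apply: measurableT_comp; first exact: measurable_shell_density.
      by apply/measurable_fun_pair => //; exact: measurable_affine2.
    move=> z; exact: shell_density_ge0.
  - apply: (measurable_fun_fubini_tonelli_F (fun z => \sum_(j < k) g j z)%E).
      exact: emeasurable_sum.
    by move=> z; rewrite sume_ge0.
  - move=> x _; apply: ge0_le_integral => //.
    + by move=> z _; exact: shell_density_ge0.
    + apply: (measurableT_comp (measurable_shell_density r rho)).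
      by apply/measurable_fun_pair => //; exact: measurable_affine2.
    + by apply: emeasurable_sum => j; exact: measurableT_comp (mg j) _.
    + by move=> z _; exact: shell_density_chain.
rewrite -(fubini_tonelli1 (fun z => \sum_(j < k) g j z)%E); last 2 first.
- exact: emeasurable_sum.
- by move=> z; rewrite sume_ge0.
rewrite ge0_integral_sum//.
rewrite (eq_bigr (fun=> shell_energy u (r + rho) (rho / k%:R))).
  by rewrite sume_const_ord.
move=> j _; rewrite (fubini_tonelli1 _ (mg j) (g0 j)).
exact: (ge0_integral2_shift f mf f0 j).
Qed.
End shell_energy.

(** * The weak-type estimate *)

Section pointwise.
Context {R : realType}.

(** The largest power [2 ^ j <= v] with [j < J] is already at least [v / 2]; the condition [1 < v]
    ensures that there is one. *)
Lemma le_dyadic_sum (v : R) (J : nat) : 1 < v <= 2 ^+ J ->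
  v <= 2 * \sum_(j < J) 2 ^+ j * (2 ^+ j <= v)%R%:R.
Proof.
move=> /andP[v1]; elim: J => [|J IHJ] vJ.
  by have := lt_le_trans v1 vJ; rewrite expr0 ltxx.
rewrite big_ord_recr/= mulrDr.
have [/IHJ vle|vgt] := leP v (2 ^+ J).
  by rewrite (le_trans vle)// lerDl !mulr_ge0// exprn_ge0.
rewrite (ltW vgt) mulr1 -exprS (le_trans vJ)// lerDr mulr_ge0// sumr_ge0//.
Qed.

(* The [p]-th power of [level p t m] is [2 ^ m] up to a factor depending only on
   [t], so the superlevel sets of these heights have measure [o(2 ^ -m)]; the
   factor [2 ^ -t] makes the part of the oscillation below all levels small. *)
Definition level (p : R) (t m : nat) : R := 2 `^ (m%:R / p) / 2 ^+ t.

Lemma level_powR (p : R) (t m : nat) : 0 < p ->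
  level p t m `^ p = 2 ^+ m / (2 ^+ t) `^ p.
Proof.
move=> p0; rewrite /level powRM ?powR_ge0 ?invr_ge0 ?exprn_ge0//.
rewrite -powRrM divfK ?gt_eqF// powR_mulrn//; congr (_ * _).
rewrite -powR_inv1 ?exprn_ge0// -powRrM mulN1r powRN.
by [].
Qed.

(** Here [e] stands for the distance of the two points and [d] for the difference of the values. The
    rescaled oscillation [w = 2 ^ k D] is either at most [2 ^- t], which gives the first term, or is
    controlled by a dyadic decomposition of the power [v] of [w 2 ^ t]. *)
Lemma dyadic_oscillation (N P t k : nat) (p d e : R) : 1 <= p -> p <= P%:R ->
  0 <= d -> 0 < e -> e <= 2 ^- k ->
  2 ^+ (k * N.+1) * Num.min 1 d <=
  2 ^+ (k * N) * 2 ^- t + 2 * \sum_(k * N <= m < k * N + (k + t) * P)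
     2 ^+ m * (level p t m <= d / e `^ (N%:R / p + 1))%R%:R.
Proof.
move=> p1 pP d0 e0 ek.
have p0 : 0 < p by exact: lt_le_trans p1.
set D := Num.min 1 d; set w := 2 ^+ k * D.
have D0 : 0 <= D by rewrite le_min ler01.
have D1 : D <= 1 by rewrite ge_min lexx.
have Dd : D <= d by rewrite ge_min lexx orbT.
have tw n : 0 < 2 ^+ n :> R by rewrite exprn_gt0.
have w0 : 0 <= w by rewrite mulr_ge0// ltW.
have -> : 2 ^+ (k * N.+1) * D = 2 ^+ (k * N) * w.
  by rewrite mulnS exprD mulrA [_ * 2 ^+ k]mulrC.
have [wt|wt] := leP (w * 2 ^+ t) 1.
  apply: ler_wpDr.
    by rewrite mulr_ge0// sumr_ge0// => m _; rewrite mulr_ge0// ltW.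
  by rewrite ler_pM2l// -[leRHS]mul1r ler_pdivlMr.
rewrite -[leLHS]add0r lerD ?mulr_ge0 ?invr_ge0 ?(ltW (tw _))//.
(* Since [w 2 ^ t > 1] and [p >= 1], this power dominates [w]; the exponent [p] is the one that
   turns [2 ^ j <= v] into a condition on [level]. *)
set v := (w * 2 ^+ t) `^ p.
have wt0 : 0 <= w * 2 ^+ t by rewrite mulr_ge0// ltW.
have wtv : w * 2 ^+ t <= v.
  by rewrite -[leLHS]powRr1//; apply: ler_powR => //; exact: ltW.
have wv : w <= v.
  by rewrite (le_trans _ wtv)// ler_peMr// exprn_ege1// ler1n.
have v1 : 1 < v := lt_le_trans wt wtv.
(* The cap [D <= 1] bounds [w 2 ^ t] by [2 ^ (k + t)], whence at most [(k + t) * P] levels. *)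
have vJ : v <= 2 ^+ ((k + t) * P).
  apply: (@le_trans _ _ ((2 ^+ (k + t)) `^ p)).
    apply: ge0_ler_powR; rewrite ?nnegrE ?(ltW p0) ?(ltW (tw _))//.
    by rewrite exprD ler_pM2r// /w ler_piMr// ltW.
  rewrite exprM -[leRHS]powR_mulrn ?(ltW (tw _))//; apply: ler_powR => //.
  by rewrite exprn_ege1// ler1n.
have := @le_dyadic_sum v ((k + t) * P); rewrite v1 vJ => /(_ isT) vle.
rewrite (le_trans (ler_wpM2l (ltW (tw _)) (le_trans wv vle)))//.
rewrite mulrCA ler_pM2l//.
have shift (F : nat -> R) a b :
    \sum_(a <= m < a + b) F m = \sum_(j < b) F (j + a)%N.
  by rewrite -{1}[a]add0n big_addn addKn big_mkord.
rewrite shift mulr_sumr.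
apply: ler_sum => j _; rewrite mulrA -exprD [(j + _)%N]addnC ler_pM2l// ler_nat.
case: (leP (2 ^+ j) v) => // jv; rewrite lt0b.
(* From [2 ^ j <= v] follows [2 ^ (j / p) <= w 2 ^ t]; the shift of the index by [k * N] adds the
   factor [2 ^ (k N / p)]. *)
apply: (@le_trans _ _ (w * 2 `^ ((k * N)%:R / p))).
  rewrite /level natrD mulrDl powRD; last by rewrite pnatr_eq0 implybT.
  rewrite -mulrA [leRHS]mulrC ler_pM2l ?powR_gt0// ler_pdivrMr//.
  have -> : w * 2 ^+ t = v `^ p^-1 by rewrite /v -powRrM mulfV ?gt_eqF// powRr1.
  rewrite powRrM powR_mulrn//.
  by apply: ge0_ler_powR;
    rewrite ?nnegrE ?invr_ge0 ?powR_ge0 ?(ltW (tw _)) ?(ltW p0).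
have q0 : 0 <= N%:R / p + 1 by rewrite addr_ge0// divr_ge0// ltW.
rewrite ler_pdivlMr ?powR_gt0//.
apply: (@le_trans _ _ (w * 2 `^ ((k * N)%:R / p) * (2 ^- k) `^ (N%:R / p + 1))).
  rewrite ler_wpM2l ?mulr_ge0 ?powR_ge0//.
  by apply: ge0_ler_powR; rewrite ?nnegrE ?(ltW e0) ?invr_ge0 ?(ltW (tw _)).
(* The exponents [k N / p] and [- k (N / p + 1)] add up to [- k], which cancels the factor [2 ^ k]
   of [w]. *)
suff -> : w * 2 `^ ((k * N)%:R / p) * (2 ^- k) `^ (N%:R / p + 1) = D by [].
have -> : (2 ^- k) `^ (N%:R / p + 1) = 2 `^ (- (k%:R * (N%:R / p + 1))) :> R.
  rewrite powRN powRrM powR_mulrn// -[in LHS]powR_inv1 ?(ltW (tw _))//.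
  by rewrite -powRrM mulN1r powRN.
rewrite -mulrA -powRD; last by rewrite pnatr_eq0 implybT.
have -> : (k * N)%:R / p - k%:R * (N%:R / p + 1) = - k%:R.
  by rewrite natrM; field; rewrite gt_eqF.
by rewrite powRN powR_mulrn// /w mulrAC divff ?mul1r// gt_eqF.
Qed.
End pointwise.

Lemma ge0_integral_lincomb {d} {T : measurableType d} {R : realType}
    (m : {measure set T -> \bar R}) (s : seq nat) (c : nat -> R)
    (f : nat -> T -> \bar R) :
  (forall i, 0 <= c i) -> (forall i, measurable_fun [set: T] (f i)) ->
  (forall i x, 0 <= f i x)%E ->
  (\int[m]_x (\sum_(i <- s) (c i)%:E * f i x) =
   \sum_(i <- s) (c i)%:E * \int[m]_x f i x)%E.
Proof.
move=> c0 mf f0; rewrite ge0_integral_sum//.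
- by apply: eq_bigr => i _; rewrite ge0_integralZl// lee_fin.
- by move=> i; exact: measurable_funeM.
- by move=> i x _; rewrite mule_ge0// lee_fin.
Qed.

Definition superlevel {R : realType} {n : nat} (p : R) (u : n.-tuple R -> R)
    (l : R) :
    set (n.-tuple R * n.-tuple R) :=
  [set xy | (xy.1 != xy.2 /\
     l <= `|u xy.1 - u xy.2| / euclidean_dist xy.1 xy.2 `^ (n%:R / p + 1))%R].

Section estimate.
Context {R : realType} {n : nat} (u : n.-tuple R -> R).
Hypothesis mfu : measurable_fun [set: n.-tuple R] u.
Local Notation T := (n.-tuple R).
Local Notation mm := (borel_lebesgue R n \x borel_lebesgue R n)%E.

Lemma euclidean_dist_gt0 (x y : T) : (0 < euclidean_dist x y) = (x != y).
Proof.
rewrite lt_neqAle sqrtr_ge0 andbT eq_sym; congr (~~ _).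
apply/eqP/eqP => [d0|->].
  apply/eq_from_tnth => i; apply/eqP.
  rewrite -subr_eq0 -normr_eq0 eq_le normr_ge0 andbT.
  by rewrite -d0 le_euclidean_dist.
by rewrite /euclidean_dist big1 ?sqrtr0// => i _; rewrite subrr expr0n.
Qed.

Lemma measurable_superlevel (p l : R) : measurable (superlevel p u l).
Proof.
pose q z := `|u z.1 - u z.2| * euclidean_dist z.1 z.2 `^ (- (n%:R / p + 1)).
rewrite (_ : superlevel p u l =
    ((fun z : T * T => euclidean_dist z.1 z.2) @^-1` `]0, +oo[) `&`
    (q @^-1` `[l, +oo[)).
  apply: measurableI; rewrite -[X in measurable X]setTI.
    by apply: measurable_euclidean_dist.
  suff mq : measurable_fun [set: T * T] q by apply: mq.
  apply: measurable_funM.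
    apply: (measurableT_comp (f := @Num.norm _ R)) => //; apply: measurable_funB.
      exact: (measurableT_comp mfu measurable_fst).
    exact: (measurableT_comp mfu measurable_snd).
  apply: (measurableT_comp (f := @powR R ^~ _)); first exact: measurable_powR.
  exact: measurable_euclidean_dist.
by apply/seteqP; split => -[x y];
  rewrite /superlevel /q/= !in_itv/= !andbT euclidean_dist_gt0 powRN; case.
Qed.

Lemma shell_inj (r : R) (z : T * T) (k k' : nat) :
  shell r (2 ^- k) z -> shell r (2 ^- k') z -> k = k'.
Proof.
wlog kk' : k k' / (k < k')%N => [h sk sk'|[_ /andP[k2 _]] [_ /andP[_]]].
  have [kk'|kk'|//] := ltngtP k k'; first exact: h.
  by apply/esym; exact: h.
move=> /(lt_le_trans k2); rewrite -invfM -exprSr ltf_pV2 ?posrE ?exprn_gt0//.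
by rewrite ltr_eXn2l ?ltr1n// ltnS leqNgt kk'.
Qed.

(* As [z] lies in at most one shell, the levels are counted once on the right,
   not once for each [k]. *)
Lemma shell_sum_le (p r : R) (P K t : nat) (z : T * T) : 1 <= p -> p <= P%:R ->
  \sum_(K <= k < K + K)
     2 ^+ (k * n.+1) * (\1_(shell r (2 ^- k)) z * oscillation u z) <=
  \sum_(K <= k < K + K) 2 ^+ (k * n) * 2 ^- t * \1_(shell r (2 ^- k)) z +
  \sum_(K * n <= m < (K + K) * n + (K + K + t) * P)
     2 * 2 ^+ m * \1_(superlevel p u (level p t m)) z.
Proof.
move=> p1 pP.
have i0 (A : set (T * T)) w : 0 <= \1_A w :> R by rewrite indicE.
have tw (m : nat) : 0 <= 2 ^+ m :> R by exact: exprn_ge0.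
have [[k [Kk zk]]|nk] :=
    pselect (exists k, k \in index_iota K (K + K) /\ shell r (2 ^- k) z);
  last first.
  rewrite big_seq big1 => [|k Kk].
    by rewrite addr_ge0// sumr_ge0// => m _; rewrite !mulr_ge0 ?invr_ge0.
  by rewrite indicE memNset ?mul0r ?mulr0// => zk; apply: nk; exists k.
rewrite (bigD1_seq k) ?iota_uniq//= big1 => [|k' k'k]; last first.
  rewrite indicE memNset ?mul0r ?mulr0// => zk'; move/eqP: k'k; apply.
  exact: shell_inj zk' zk.
rewrite addr0 indicE mem_set// mul1r.
rewrite [X in _ <= X + _](bigD1_seq k) ?iota_uniq//= indicE mem_set// mulr1.
case: (zk) => _ /andP[k2 ke].
have d0 : 0 < euclidean_dist z.1 z.2.
  by apply: le_lt_trans k2; rewrite divr_ge0// invr_ge0.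
apply: (le_trans (dyadic_oscillation n P t k p _ _ p1 pP
  (normr_ge0 (u z.1 - u z.2)) d0 ke)).
rewrite -addrA lerD2l; apply: ler_wpDl.
  by rewrite sumr_ge0// => m _; rewrite !mulr_ge0 ?invr_ge0.
move: Kk; rewrite mem_index_iota => /andP[Kk kK].
(* As [K <= k < 2 K], the levels that belong to [k] form a subinterval of the common range; the
   terms on either side of it are nonnegative. *)
rewrite [leRHS](@big_cat_nat _ _ _ (k * n))/=; last 2 first.
- by rewrite leq_mul2r Kk orbT.
- by rewrite (leq_trans _ (leq_addr _ _))// leq_mul2r (ltnW kK) orbT.
rewrite [X in _ <= _ + X](@big_cat_nat _ _ _ (k * n + (k + t) * P))/=;
  last 2 first.
- exact: leq_addr.
- by rewrite leq_add// ?leq_mul2r ?leq_add2r (ltnW kK) orbT.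
rewrite [leRHS]addrCA; apply: ler_wpDr.
  by rewrite addr_ge0// sumr_ge0// => m _; rewrite !mulr_ge0.
rewrite mulr_sumr ler_sum// => m _.
rewrite -mulrA !ler_pM2l ?exprn_gt0// indicE ler_nat.
case: leP => // ml; rewrite lt0b; apply/mem_set; split => //.
by rewrite -euclidean_dist_gt0.
Qed.

(** After the substitution [y = x + rho z], the shell lies over pairs with [x] in [box r] and
    [|z| <= 1], hence with [z] in [box 1]. *)
Lemma measure_shell_le (r rho : R) : 0 < rho ->
  (mm (shell r rho) <= (rho ^+ n)%:E *
     (borel_lebesgue R n (box r) * borel_lebesgue R n (box 1)))%E.
Proof.
move=> rho0.
have rn0 : 0 <= rho ^+ n by rewrite exprn_ge0// ltW.
pose f (z : T * T) := (\1_(shell r rho) z)%:E : \bar R.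
have mf : measurable_fun [set: T * T] f.
  by apply/measurable_EFinP; apply: measurable_indic; exact: measurable_shell.
have f0 z : (0 <= f z)%E by rewrite lee_fin indicE.
have mb : measurable (box r `*` box 1 : set (T * T)).
  by apply: measurableX; exact: measurable_box.
have mE (A : set (T * T)) : measurable A -> mm A = (\int[mm]_z (\1_A z)%:E)%E.
  by move=> mA; rewrite integral_indic// setIT.
rewrite (mE _ (measurable_shell _ _)).
rewrite -[leLHS]/(\int[mm]_z f z)%E (fubini_tonelli1 f mf f0).
rewrite [leLHS](ge0_integral2_affine f mf f0 rho rho0).
apply: lee_wpmul2l; first by rewrite lee_fin.
rewrite -product_measure1E; [|exact: measurable_box|exact: measurable_box].
pose g (z : T * T) := f (z.1, affine rho z.1 z.2).
have mg : measurable_fun [set: T * T] g.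
  apply: measurableT_comp => //; apply/measurable_fun_pair => //.
  exact: measurable_affine2.
have g0 z : (0 <= g z)%E by exact: f0.
rewrite -[leLHS](fubini_tonelli1 g mg g0).
rewrite [leRHS](mE _ mb).
apply: ge0_le_integral => //.
- by apply/measurable_EFinP; exact: measurable_indic.
move=> [x z] _; rewrite lee_fin !indicE ler_nat.
case: (boolP (_ \in shell _ _)) => // /set_mem[/= xr /andP[_ zr]].
rewrite lt0b; apply/mem_set; split => //= i.
have := le_trans (le_euclidean_dist _ _ i) zr.
rewrite tnth_mktuple opprD addrA subrr add0r normrN normrM gtr0_norm//.
by rewrite -[X in _ <= X -> _]mulr1 ler_pM2l.
Qed.

Lemma box_lty (r : R) : (borel_lebesgue R n (box r) < +oo)%E.
Proof.
rewrite (_ : box r = [set x : T | forall i, `[- r, r]%classic (tnth x i)]);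
  last first.
  by apply/seteqP; split => x /= xr i; have := xr i; rewrite /= in_itv/= ler_norml.
rewrite (@borel_lebesgue_box R n (fun=> `[- r, r]%classic))//.
suff : (\prod_(i < n)
    lebesgue_measure (`[(- r)%R, r]%classic : set R))%E \is a fin_num.
  by rewrite fin_numElt => /andP[].
elim/big_ind : _ => // [x y|i _]; first exact: fin_numM.
by rewrite lebesgue_measure_itv/=; case: ifP.
Qed.

(** Integrate [shell_sum_le]. By [measure_shell_le] the weight [2 ^ (k n)] cancels the measure of
    the shell, so every [k] contributes the same constant times [2 ^- t]. *)
Lemma shell_energy_sum_le (p r : R) (P K t : nat) : 1 <= p -> p <= P%:R ->
  (\sum_(K <= k < K + K) (2 ^+ (k * n.+1))%:E * shell_energy u r (2 ^- k) <=
  \sum_(K <= k < K + K) (2 ^- t)%:E *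
     (borel_lebesgue R n (box r) * borel_lebesgue R n (box 1)) +
  \sum_(K * n <= m < (K + K) * n + (K + K + t) * P)
     (2 * 2 ^+ m)%:E * mm (superlevel p u (level p t m)))%E.
Proof.
move=> p1 pP.
have tw (m : nat) : 0 <= 2 ^+ m :> R by exact: exprn_ge0.
pose a k : R := 2 ^+ (k * n) * 2 ^- t; pose b m : R := 2 * 2 ^+ m.
pose A k : set (T * T) := shell r (2 ^- k).
pose B m := superlevel p u (level p t m).
pose iA k (z : T * T) : \bar R := (\1_(A k) z)%:E.
pose iB m (z : T * T) : \bar R := (\1_(B m) z)%:E.
have a0 k : 0 <= a k by rewrite mulr_ge0 ?invr_ge0.
have b0 k : 0 <= b k by rewrite mulr_ge0.
have iA0 k z : (0 <= iA k z)%E by rewrite lee_fin indicE.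
have iB0 k z : (0 <= iB k z)%E by rewrite lee_fin indicE.
have mA k : measurable (A k) by exact: measurable_shell.
have mB k : measurable (B k) by exact: measurable_superlevel.
have miA k : measurable_fun [set: T * T] (iA k).
  by apply/measurable_EFinP; exact: measurable_indic.
have miB k : measurable_fun [set: T * T] (iB k).
  by apply/measurable_EFinP; exact: measurable_indic.
pose h k := shell_density u r (2 ^- k).
have mh k : measurable_fun [set: T * T] (h k).
  exact: measurable_shell_density.
have h0 k z : (0 <= h k z)%E by exact: shell_density_ge0.
have hE k : shell_energy u r (2 ^- k) = (\int[mm]_z h k z)%E.
  by rewrite (fubini_tonelli1 (h k) (mh k) (h0 k)).
under eq_bigr do rewrite hE.
rewrite -ge0_integral_lincomb//.
pose SA z := (\sum_(K <= k < K + K) (a k)%:E * iA k z)%E.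
pose SB z :=
  (\sum_(K * n <= m < (K + K) * n + (K + K + t) * P) (b m)%:E * iB m z)%E.
have mSA : measurable_fun [set: T * T] SA.
  by apply: emeasurable_sum => k; exact: measurable_funeM.
have mSB : measurable_fun [set: T * T] SB.
  by apply: emeasurable_sum => k; exact: measurable_funeM.
have SA0 z : (0 <= SA z)%E.
  by apply: sume_ge0 => k _; rewrite mule_ge0// lee_fin.
have SB0 z : (0 <= SB z)%E.
  by apply: sume_ge0 => k _; rewrite mule_ge0// lee_fin.
apply: (@le_trans _ _ (\int[mm]_z (SA z + SB z))%E).
  apply: ge0_le_integral => //.
  - move=> z _; apply: sume_ge0 => k _; apply: mule_ge0; last exact: h0.
    by rewrite lee_fin; exact: tw.
  - by apply: emeasurable_sum => k; exact: measurable_funeM.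
  - exact: emeasurable_funD.
  - move=> z _; have := shell_sum_le p r P K t z p1 pP.
    rewrite -lee_fin EFinD -!sumEFin.
    by under eq_bigr do rewrite EFinM.
rewrite ge0_integralD// !ge0_integral_lincomb//.
have indE (X : set (T * T)) : measurable X -> (\int[mm]_z (\1_X z)%:E)%E = mm X.
  by move=> mX; rewrite integral_indic// setIT.
apply: leeD.
  apply: lee_sum => k _.
  rewrite [X in (_ * X)%E](indE _ (mA k)) {1}/a mulrC EFinM -muleA.
  rewrite lee_pmul2l ?lte_fin ?invr_gt0 ?exprn_gt0//.
  apply: (le_trans (lee_wpmul2l _ (measure_shell_le r (2 ^- k) _))).
  - by rewrite lee_fin.
  - by rewrite invr_gt0 exprn_gt0.
  by rewrite muleA -EFinM -exprVn -exprM exprVn divff ?mul1e// expf_neq0.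
by apply: lee_sum => k _; rewrite [X in (_ * X)%E](indE _ (mB k)).
Qed.

End estimate.

(** * Vanishing of the energies and constancy of Borel functions *)

Lemma levels_count_le (K n P t : nat) : (0 < K)%N ->
  ((K + K) * n + (K + K + t) * P - K * n <= K * (2 * n + 2 * P + t * P).+1)%N.
Proof. by move=> K0; nia. Qed.

(** First [l] is taken so large that [d 2 ^ l > 1], then [i] is the least exponent with
    [d 2 ^ l <= 2 ^ i]; it is positive, so minimality applies to [i - 1]. *)
Lemma dyadic_scale {R : realType} (d : R) : 0 < d ->
  exists i l : nat, 2 ^+ i / 2 ^+ l / 2 < d <= 2 ^+ i / 2 ^+ l.
Proof.
move=> d0; pose l := Num.bound d^-1.
have tl : 0 < 2 ^+ l :> R by rewrite exprn_gt0.
have dl : 1 < d * 2 ^+ l.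
  by rewrite mulrC -ltr_pdivrMr// mul1r; exact: upper_nthrootP.
have ex : exists i, d * 2 ^+ l <= 2 ^+ i.
  by exists (Num.bound (d * 2 ^+ l)); rewrite ltW//; exact: upper_nthrootP.
case: (ex_minnP ex) => -[|i] di imin.
  by move: di; rewrite expr0 leNgt dl.
exists i.+1, l; rewrite ler_pdivlMr// di andbT mulrAC ltr_pdivrMr//.
rewrite exprSr mulfK//.
by rewrite ltNge; apply/negP => /imin; rewrite ltnn.
Qed.

Lemma ge0_integral_eq0_negligible {d} {T : measurableType d} {R : realType}
    (m : {measure set T -> \bar R}) (f : T -> \bar R) :
  measurable_fun [set: T] f -> (forall x, 0 <= f x)%E ->
  (\int[m]_x f x = 0)%E -> m.-negligible [set x | f x != 0%E].
Proof.
move=> mf f0 if0.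
have /(ae_eq_integral_abs m measurableT mf) : (\int[m]_x `|f x| = 0)%E.
  by rewrite -[RHS]if0; apply: eq_integral => x _; rewrite gee0_abs.
move=> [A [mA A0 fA]]; exists A; split => //.
apply: subset_trans fA => x /= /eqP fx0 h.
by apply: fx0; exact: h.
Qed.

Section vanishing.
Context {R : realType} {n : nat} (u : n.-tuple R -> R) (p : R).
Hypotheses (mfu : measurable_fun [set: n.-tuple R] u).
Hypotheses (n0 : (0 < n)%N) (p1 : 1 <= p).
Local Notation T := (n.-tuple R).
Local Notation mm := (borel_lebesgue R n \x borel_lebesgue R n)%E.
Hypothesis weak_lim : forall eta : R, 0 < eta ->
  exists A : R, forall l, A < l ->
  ((l `^ p)%:E * mm (superlevel p u l) <= eta%:E)%E.

Lemma level_gt (A : R) (t : nat) :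
  exists m0, forall m, (m0 <= m)%N -> A < level p t m.
Proof.
have p0 : 0 < p by exact: lt_le_trans p1.
pose P := Num.bound p; pose s := Num.bound (A * 2 ^+ t).
have pP : p <= P%:R by rewrite ltW// archi_boundP// ltW.
exists (P * s)%N => m Pm; rewrite /level ltr_pdivlMr ?exprn_gt0//.
have As : A * 2 ^+ t < 2 ^+ s by exact: upper_nthrootP.
apply: (lt_le_trans As); rewrite -powR_mulrn//.
apply: ler_powR; first by rewrite ler1n.
rewrite ler_pdivlMr// (le_trans _ (_ : (P * s)%:R <= _))//;
  last by rewrite ler_nat.
by rewrite mulnC natrM ler_wpM2l.
Qed.

(** If all weighted energies beyond [k0] exceeded [eps], their sum over [K <= k < 2 K] would be at
    least [K eps], whereas [shell_energy_sum_le] bounds it by [K eps / 2]. *)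
Lemma shell_energy_small (r eps : R) (k0 : nat) : 0 < eps ->
  exists k, (k0 <= k)%N /\
  ((2 ^+ (k * n.+1))%:E * shell_energy u r (2 ^- k) <= eps%:E)%E.
Proof.
move=> eps0; have eps4 : eps / 4 + eps / 4 < eps by lra.
have p0 : 0 < p by exact: lt_le_trans p1.
pose P := Num.bound p.
have pP : p <= P%:R by rewrite ltW// archi_boundP// ltW.
pose C := fine (borel_lebesgue R n (box r) * borel_lebesgue R n (box 1))%E.
have CE : (borel_lebesgue R n (box r) * borel_lebesgue R n (box 1) = C%:E)%E.
  by rewrite fineK// fin_numM// ge0_fin_numE// box_lty.
have C0 : 0 <= C by rewrite fine_ge0// mule_ge0.
(* This [t] makes the part below all levels cost at most [eps / 4] for each [k]; it is fixed before
   [eta] and [K]. *)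
pose t := Num.bound (C * 4 / eps).
have Ct : 2 ^- t * C <= eps / 4.
  have : C * 4 / eps < 2 ^+ t by exact: upper_nthrootP.
  rewrite ltr_pdivrMr// => /ltW h; rewrite mulrC ler_pdivrMr ?exprn_gt0//.
  by rewrite mulrAC ler_pdivlMr// mulrC [eps * _]mulrC // mulrC.
(* There are at most [K * Q] levels, with [Q] independent of [K]. Hence [eta] can be chosen before
   [K] so that each level costs at most [eps / (4 Q)]. [Q] is kept opaque for the computations. *)
have [Q QE] : exists Q : nat, Q = (2 * n + 2 * P + t * P).+1 by eexists.
have Q0 : 0 < Q%:R :> R by rewrite ltr0n QE.
pose eta := eps / (8 * Q%:R) / (2 ^+ t) `^ p.
have t2p : 0 < (2 ^+ t) `^ p :> R by rewrite powR_gt0 ?exprn_gt0.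
have eta0 : 0 < eta by rewrite !divr_gt0// mulr_gt0.
have [A hA] := weak_lim _ eta0.
have [m0 hm0] := level_gt A t.
pose K := (k0 + m0).+1.
apply: contrapT => /forallNP nk.
have big k : (K <= k)%N ->
    (eps%:E <= (2 ^+ (k * n.+1))%:E * shell_energy u r (2 ^- k))%E.
  move=> Kk; rewrite leNgt; apply/negP => /ltW h; apply: (nk k); split => //.
  by apply: leq_trans Kk; rewrite /K -addnS leq_addr.
have := shell_energy_sum_le u mfu p r P K t p1 pP.
rewrite leNgt => /negP; apply.
have tail m : (K * n <= m)%N ->
    ((2 * 2 ^+ m)%:E * mm (superlevel p u (level p t m)) <=
     (eps / (4 * Q%:R))%:E)%E.
  (* Here [0 < n] is essential: the lowest level [K * n] must go to infinity with [K]. *)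
  move=> Km; have /hm0/hA : (m0 <= m)%N.
    by apply: leq_trans Km; rewrite -[m0]muln1 leq_mul// /K -addSn leq_addl.
  rewrite level_powR// => h.
  have -> : 2 * 2 ^+ m = (2 * (2 ^+ t) `^ p) * (2 ^+ m / (2 ^+ t) `^ p) :> R.
    by field; rewrite gt_eqF.
  rewrite EFinM -muleA; apply: le_trans (lee_wpmul2l _ h) _.
    by rewrite lee_fin mulr_ge0// ltW.
  rewrite -EFinM lee_fin le_eqVlt; apply/orP; left; apply/eqP.
  by rewrite /eta; field; rewrite !gt_eqF.
apply: (@le_lt_trans _ _ ((K%:R * (eps / 4) + K%:R * (eps / 4))%:E)).
  rewrite CE EFinD; apply: leeD.
    rewrite -EFinM sumEFin lee_fin sumr_const_nat addnK -[leLHS]mulr_natl.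
    by apply: ler_wpM2l.
  apply: (@le_trans _ _ (\sum_(K * n <= m < (K + K) * n + (K + K + t) * P)
      (eps / (4 * Q%:R))%:E)%E).
    by rewrite big_nat [leRHS]big_nat; apply: lee_sum => m /andP[/tail].
  rewrite sumEFin lee_fin sumr_const_nat -[leLHS]mulr_natl.
  apply: (@le_trans _ _ ((K * Q)%:R * (eps / (4 * Q%:R)))).
    rewrite ler_wpM2r ?divr_ge0 ?mulr_ge0 ?(ltW eps0)// ler_nat QE.
    exact: levels_count_le.
  by rewrite natrM le_eqVlt; apply/orP; left; apply/eqP; field; rewrite gt_eqF.
apply: (@lt_le_trans _ _ (K%:R * eps)%:E).
  by rewrite lte_fin -mulrDr ltr_pM2l// ltr0n.
apply: (@le_trans _ _ (\sum_(K <= k < K + K) eps%:E)%E).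
  by rewrite sumEFin lee_fin sumr_const_nat addnK [leLHS]mulr_natl.
by rewrite big_nat [leRHS]big_nat; apply: lee_sum => m /andP[/big].
Qed.

(** Cut the segments so finely that the pieces have scale [2 ^- k], where [k] is one of the good
    scales of [shell_energy_small] for the enlarged box. *)
Lemma shell_energy_eq0 (r : R) (i l : nat) :
  shell_energy u r (2 ^+ i / 2 ^+ l) = 0%E.
Proof.
have tw (m : nat) : 0 < 2 ^+ m :> R by rewrite exprn_gt0.
apply/eqP; rewrite eq_le; apply/andP; split; last first.
  apply: integral_ge0 => x _; apply: integral_ge0 => y _.
  exact: shell_density_ge0.
apply/lee_addgt0Pr => eps eps0; rewrite add0e.
have [k [lk hk]] := shell_energy_small (r + 2 ^+ i / 2 ^+ l)
  (eps / (2 ^+ i) ^+ n.+1) l (divr_gt0 eps0 (exprn_gt0 _ (tw i))).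
(* With this number of pieces the radius becomes exactly [2 ^- k]. Since [q <= 2 ^ i * 2 ^ k], the
   chain factor costs only a power of [2 ^ i] beyond the weight [2 ^ (k (n + 1))], and the choice of
   epsilon above absorbs it. *)
pose q := (2 ^ i * 2 ^ (k - l))%N.
have qE : q%:R = 2 ^+ i * 2 ^+ (k - l) :> R by rewrite natrM !natrX.
have q0 : (0 < q)%N by rewrite muln_gt0 !expn_gt0.
apply: le_trans (shell_energy_chain u mfu r _ _ q0 (divr_gt0 (tw i) (tw l))) _.
have -> : 2 ^+ i / 2 ^+ l / q%:R = 2 ^- k :> R.
  rewrite qE -[in RHS](subnKC lk) exprD; field.
  by rewrite !gt_eqF.
set W := shell_energy _ _ _ in hk *.
have W0 : (0 <= W)%E.
  apply: integral_ge0 => x _; apply: integral_ge0 => y _.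
  exact: shell_density_ge0.
apply: (@le_trans _ _ (((2 ^+ i) ^+ n.+1)%:E * ((2 ^+ (k * n.+1))%:E * W))%E).
  rewrite muleA -EFinM lee_wpmul2r// lee_fin qE exprMn exprM.
  rewrite ler_pM2l ?exprn_gt0//.
  rewrite lerXn2r ?nnegrE ?(ltW (tw _))//.
  by rewrite ler_eXn2l ?ltr1n// leq_subr.
apply: le_trans (lee_wpmul2l _ hk) _; first by rewrite lee_fin exprn_ge0// ltW.
by rewrite -EFinM lee_fin mulrC divfK// gt_eqF// exprn_gt0.
Qed.

(** Countably many shells cover all pairs of distinct points, so [u x = u y] for almost every pair.
    By Fubini some section at a point [x0] is null, and [u x0] is the constant. *)
Lemma ae_cst_of_weak_lim : exists (c : R) (Z : set T),
  [/\ measurable Z, borel_lebesgue R n Z = 0%E & forall x, ~ Z x -> u x = c].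
Proof.
pose Z : set (T * T) := [set z | oscillation u z != 0].
have mZ : measurable Z.
  rewrite (_ : Z = oscillation u @^-1` (~` [set 0])).
    rewrite -[X in measurable X]setTI.
    by apply: (measurable_oscillation u mfu) => //; apply: measurableC.
  by apply/seteqP; split => z /= /eqP.
have Z0 : mm Z = 0%E.
  apply/(negligibleP mm mZ).
  apply: (@negligibleS _ _ _ mm (\bigcup_r \bigcup_i \bigcup_l
      [set z | shell_density u r%:R (2 ^+ i / 2 ^+ l) z != 0%E])).
    move=> z Zz; have d0 : 0 < euclidean_dist z.1 z.2.
      rewrite euclidean_dist_gt0; apply: contra_neq Zz => z12.
      by rewrite /oscillation z12 subrr normr0; apply/min_idPr.
    have [i [l il]] := dyadic_scale _ d0.
    exists (Num.bound (\sum_(j < n) `|tnth z.1 j|)) => //.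
    exists i => //; exists l => //=.
    rewrite eqe mulf_neq0// indicE mem_set ?oner_neq0//; split => // j.
    apply: (@le_trans _ _ (\sum_(j < n) `|tnth z.1 j|)).
      by rewrite (bigD1 j)//= lerDl sumr_ge0.
    by rewrite ltW// archi_boundP// sumr_ge0.
  apply: negligible_bigcup => r; apply: negligible_bigcup => i.
  apply: negligible_bigcup => l; apply: ge0_integral_eq0_negligible.
  - exact: measurable_shell_density.
  - exact: shell_density_ge0.
  - rewrite (fubini_tonelli1 _ (measurable_shell_density u mfu _ _)
      (shell_density_ge0 u _ _)).
    exact: shell_energy_eq0.
have /ge0_integral_eq0_negligible : (\int[borel_lebesgue R n]_x
    (borel_lebesgue R n \o xsection Z) x = 0)%E by exact: Z0.
move=> /(_ (measurable_fun_xsection _ mZ) (fun=> measure_ge0 _ _)) Zneg.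
have [x0 x0Z] : exists x0, borel_lebesgue R n (xsection Z x0) = 0%E.
  (* Otherwise every point would belong to a null set, although the unit cube has measure [1]. *)
  apply: contrapT => /forallNP nZ.
  have : borel_lebesgue R n setT = 0%E.
    apply/negligibleP => //; apply: negligibleS Zneg => x _ /=.
    by apply/eqP; exact: nZ.
  pose I01 : set R := `[0, 1]%classic.
  have mI : measurable I01 by exact: measurable_itv.
  have : borel_lebesgue R n [set x | forall i, I01 (tnth x i)] = 1%E.
    rewrite (@borel_lebesgue_box R n (fun=> I01))// big1// => i _.
    by rewrite lebesgue_measure_itv/= lte01 oppr0 adde0.
  move=> h1 h0; have : (1 <= 0 :> \bar R)%E.
    rewrite -h1 -h0 le_measure ?inE//.
    rewrite (_ : [set _ | _] =
        \bigcap_(i in [set: 'I_n]) (fun x : T => tnth x i) @^-1` I01).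
      apply: fin_bigcap_measurable => // i _; rewrite -[X in measurable X]setTI.
      by apply: (measurable_tnth i).
    by apply/seteqP; split => x /= xr i; [move=> _|]; exact: xr.
  by rewrite lee_fin ler10.
exists (u x0), (xsection Z x0); split => //.
  exact: measurable_xsection.
move=> x /xsectionP nZ; apply/eqP; rewrite eq_sym -subr_eq0 -normr_eq0.
apply: contrapT => /negP u0; apply: nZ.
rewrite /Z/= /oscillation/= gt_eqF// lt_min ltr01 /= lt_neqAle eq_sym u0.
by rewrite normr_ge0.
Qed.
End vanishing.

(** * From Borel to Lebesgue measurable functions *)

Lemma cvg0_pinfty_lt {R : realType} (f : R -> \bar R) (eta : R) : 0 < eta ->
  f l @[l --> +oo%R] --> 0%E ->
  exists A : R, forall l, A < l -> (f l < eta%:E)%E.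
Proof.
move=> eta0 f0.
have : nbhs (0%E : \bar R) [set x | (x < eta%:E)%E].
  apply: open_nbhs_nbhs; split; first exact: open_ereal_lt_ereal.
  by rewrite /= lte_fin.
by move=> /f0 [A [_ hA]]; exists A => l /hA.
Qed.

Lemma mu_extU0 {d} {T : measurableType d} {R : realType}
    (m : {measure set T -> \bar R}) (A B : set T) :
  measurable B -> m B = 0%E -> (mu_ext m (A `|` B) <= mu_ext m A)%E.
Proof.
move=> mB B0; apply: le_trans (outer_measureU2 (mu_ext m) A B) _.
rewrite -[leRHS]adde0; apply: leeD => //.
by rewrite [leLHS](measurable_mu_extE m)// B0.
Qed.

Theorem theorem2 (R : realType) (N : nat) (p : R) (u : N.-tuple R -> R) :
  (1 <= N)%N -> 1 <= p ->
  measurable_fun [set: lebesgue_type R N] (u : lebesgue_type R N -> R) ->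
  ((l `^ p)%:E * lebesgue2 R N
     [set xy : N.-tuple R * N.-tuple R | (xy.1 != xy.2 /\
        l <= `|u xy.1 - u xy.2| /
             euclidean_dist xy.1 xy.2 `^ (N%:R / p + 1))%R])%E
    @[l --> +oo%R] --> 0%E ->
  exists c : R, {ae lebesgue R N, forall x : N.-tuple R, u x = c}.
Proof.
move=> N1 p1 mfu lim0.
have sf := sigma_finiteT (borel_lebesgue R N).
have [g [Z [mg mZ Z0 ug]]] :=
  caratheodory_measurable_fun_borel (borel_lebesgue R N) u sf mfu.
pose mm := (borel_lebesgue R N \x borel_lebesgue R N)%E.
(* The pairs with at least one coordinate in [Z]: outside this null set the difference quotients of
   [u] and [g] coincide. *)
pose ZZ : set (N.-tuple R * N.-tuple R) := (Z `*` setT) `|` (setT `*` Z).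
have mZZ : measurable ZZ by apply: measurableU; exact: measurableX.
have ZZ0 : mm ZZ = 0%E.
  apply/negligibleP => //; apply: negligibleU; apply/negligibleP.
  - exact: measurableX.
  - by rewrite [LHS](product_measure1E _ _ mZ measurableT) Z0 mul0e.
  - exact: measurableX.
  - by rewrite [LHS](product_measure1E _ _ measurableT mZ) Z0 mule0.
have wg (eta : R) : 0 < eta -> exists A : R, forall l, A < l ->
    ((l `^ p)%:E * mm (superlevel p g l) <= eta%:E)%E.
  move=> eta0; have [A hA] := cvg0_pinfty_lt _ _ eta0 lim0.
  exists A => l /hA/ltW; apply: le_trans; apply: lee_wpmul2l.
    by rewrite lee_fin powR_ge0.
  (* [lebesgue2] is the outer measure itself, so the comparison takes place between outer measures:
     the superlevel set of [g] lies in that of [u] enlarged by [ZZ]. *)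
  rewrite -[leLHS](measurable_mu_extE _ (measurable_superlevel g mg p l)).
  apply: le_trans (mu_extU0 mm (superlevel p u l) _ mZZ ZZ0).
  apply: le_mu_ext => -[x y] gxy.
  have [Zx|Zx] := pselect (Z x); first by right; left.
  have [Zy|Zy] := pselect (Z y); first by right; right.
  by left; move: gxy; rewrite /superlevel/= !ug.
have [c [Z' [mZ' Z'0 gc]]] := ae_cst_of_weak_lim g p mg N1 p1 wg.
have mU : measurable (Z `|` Z') by exact: measurableU.
exists c; exists (Z `|` Z').
split.
- exact: caratheodory_measurable_mu_ext.
- rewrite -[LHS]/(mu_ext (borel_lebesgue R N) (Z `|` Z')) measurable_mu_extE//.
  by apply/negligibleP => //; apply: negligibleU; apply/negligibleP.
- move=> x /= ucx; apply: contrapT => /not_orP[Zx Zx']; apply: ucx.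
  by rewrite ug// gc.
Qed.
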